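(* Let $M$ denote the generic poset, and let $A$ be a countably infinite poset. Then there exists an embedding $f : A \to M$ such that $M \setminus f(A)$ is infinite and every automorphism of the induced subposet $f(A)$ extends uniquely to an automorphism of $M$.
   Context: The generic poset $M$ is the Fraïssé limit of the class of all finite posets: the unique (up to isomorphism) countable poset which is ultrahomogeneous (every isomorphism between finite subposets extends to an automorphism of $M$) and into which every finite poset embeds. An embedding of posets is an injective map $f$ with $x < y \iff f(x) < f(y)$. *)

(* Defs.v *)
From mathcomp Require Import all_boot all_order.
From mathcomp Require Import mathcomp_extra boolp classical_sets functions.
From mathcomp Require Import cardinality.

Set Implicit Arguments.
Unset Strict Implicit.
Unset Printing Implicit Defensive.

Local Open Scope classical_set_scope.
Local Open Scope order_scope.

Definition poset_embedding (d d' : Order.disp_t) (P : porderType d)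
    (Q : porderType d') (f : P -> Q) : Prop :=
  injective f /\ {mono f : x y / x < y}.

Definition poset_automorphism (d : Order.disp_t) (P : porderType d)
    (g : P -> P) : Prop :=
  bijective g /\ {mono g : x y / x < y}.

(* An isomorphism between the induced subposets X and Y of P is represented by
   a total map h : P -> P of which only the values on X matter. *)
Definition subposet_isomorphism (d : Order.disp_t) (P : porderType d)
    (X Y : set P) (h : P -> P) : Prop :=
  set_bij X Y h /\ {in X &, {mono h : x y / x < y}}.

Definition extends_to_automorphism (d : Order.disp_t) (P : porderType d)
    (X : set P) (h g : P -> P) : Prop :=
  poset_automorphism g /\ {in X, g =1 h}.

Definition ultrahomogeneous (d : Order.disp_t) (P : porderType d) : Prop :=
  forall (X Y : set P) (h : P -> P),
    finite_set X -> finite_set Y -> subposet_isomorphism X Y h ->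
    exists g : P -> P, extends_to_automorphism X h g.

Definition embeds_finite_posets (d : Order.disp_t) (P : porderType d) : Prop :=
  forall (e : Order.disp_t) (F : finPOrderType e),
    exists f : F -> P, poset_embedding f.

Definition generic_poset (d : Order.disp_t) (P : porderType d) : Prop :=
  [/\ countable [set: P], ultrahomogeneous P & embeds_finite_posets P].

(* Main.v *)
(**
A down-set Z of A is fixed which is invariant under Aut(A) and is not generated
by finitely many elements; up to reversing both orders one exists in every
infinite poset. From a poset P with such a Z a larger one is built by adding
- caps s(W, i), where W = L u Z with L a finitely generated down-set: the
  elements below s(W, i) are those of W and none is above;
- cuts x(L, U, j), for finitely generated L < U with U disjoint from Z, with
  x(L, U, j) < s(L u Z, i) exactly when j <= i;
and the new Z is {x(0, 0, j) : j in nat}. The construction is functorial, so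
automorphisms of A extend to the limit B of the iterated construction. The cuts
give B the extension property, hence B is isomorphic to M by back and forth.

An automorphism g of B fixing A pointwise is the identity. Suppose g fixes stage
n pointwise. The caps of stage n are the minimal elements, outside stage n, of
the set of upper bounds of Z_n, hence g permutes the caps s(W, i) with W given.
A cut x(L, U, j) is maximal among the elements below infinitely many
s(L u Z_n, i), all such maximal elements belong to stage n + 1, and j is the
number of these caps which are not above it; so g fixes it. Finally s(L u Z_n, i)
is determined by the cuts x(L, 0, j) below it.
*)
From Stdlib Require List.
From HB Require Import structures.
Require Import Defs.
From mathcomp Require Import all_boot all_order.
From mathcomp Require Import mathcomp_extra boolp classical_sets functions.
From mathcomp Require Import cardinality.

Set Implicit Arguments.
Unset Strict Implicit.
Unset Printing Implicit Defensive.

Local Open Scope classical_set_scope.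
Import List (In, app).

(** * Order automorphisms and finitely generated down-sets *)

Definition order_aut (T : Type) (lt : T -> T -> Prop) (g g' : T -> T) :=
  [/\ cancel g g', cancel g' g & forall x y, lt (g x) (g y) <-> lt x y].

Lemma order_aut_sym (T : Type) (lt : T -> T -> Prop) (g g' : T -> T) :
  order_aut lt g g' -> order_aut lt g' g.
Proof.
by case=> gK g'K gE; split=> // b c; rewrite -(gE (g' b)) !g'K.
Qed.

Lemma in_map (T T' : Type) (f : T -> T') (s : seq T) y :
  In y [seq f x | x <- s] <-> exists2 x, In x s & y = f x.
Proof.
elim: s => [|x s IH] /=; first by split=> // -[].
split=> [[<-|/IH [z sz ->]]|[z [<-|sz] yE]]; [by exists x; [left|]| | by left|].
- by exists z => //; right.
- by right; apply/IH; exists z.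
Qed.

Section finitely_generated.
Variables (T : Type) (lt : T -> T -> Prop).

Definition le (p q : T) := p = q \/ lt p q.

Definition down (F : seq T) : set T := [set p | exists2 f, In f F & le p f].

Definition up (G : seq T) : set T := [set p | exists2 g, In g G & le g p].

Definition fin_gen (X : set T) := exists F, X = down F.

Lemma down_nil : down [::] = set0.
Proof. by apply/predeqP => p; split=> // -[f []]. Qed.

Lemma up_nil : up [::] = set0.
Proof. by apply/predeqP => p; split=> // -[f []]. Qed.

Lemma in_down F f : In f F -> down F f.
Proof. by move=> Ff; exists f => //; left. Qed.

Lemma in_up F f : In f F -> up F f.
Proof. by move=> Ff; exists f => //; left. Qed.

Lemma down_app F F' : down (app F F') = down F `|` down F'.
Proof.
apply/predeqP => p; split.
  by case=> f /List.in_app_iff [] Ff lpf; [left|right]; exists f.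
by case=> -[f Ff lpf]; exists f => //; apply/List.in_app_iff; [left|right].
Qed.

Hypothesis lt_trans : forall p q r, lt p q -> lt q r -> lt p r.

Lemma le_lt_trans p q r : le p q -> lt q r -> lt p r.
Proof. by case=> [->//|]; apply: lt_trans. Qed.

Lemma lt_le_trans p q r : lt p q -> le q r -> lt p r.
Proof. by move=> pq [<-//|]; apply: lt_trans. Qed.

Lemma le_trans p q r : le p q -> le q r -> le p r.
Proof. by case=> [->//|pq qr]; right; apply: lt_le_trans qr. Qed.

Lemma down_closed F p q : le p q -> down F q -> down F p.
Proof. by move=> pq [f Ff qf]; exists f => //; apply: le_trans qf. Qed.

Lemma up_closed G p q : le p q -> up G p -> up G q.
Proof. by move=> pq [f Ff fp]; exists f => //; apply: le_trans pq. Qed.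

End finitely_generated.

Lemma pigeonhole (T : Type) (G : seq T) (Q : set nat) (R : T -> set nat) :
  infinite_set Q -> (forall i, Q i -> exists2 g, In g G & R g i) ->
  exists2 g, In g G & infinite_set (R g).
Proof.
move=> Qinf QR; apply: contrapT => noG; apply: Qinf.
have {noG} Rfin g : In g G -> finite_set (R g).
  by move=> Gg; apply: contrapT => Rg; apply: noG; exists g.
elim: G Q QR Rfin => [|g G IH] Q QR Rfin.
  by apply: sub_finite_set (@finite_set0 nat) => i /QR [? []].
apply: (@sub_finite_set _ _ (R g `|` (Q `\` R g))).
  by move=> i Qi; case: (pselect (R g i)) => [|NR]; [left|right].
rewrite finite_setU; split; first by apply: Rfin; left.
apply: IH => [i [/QR [g' [<-//|]]]|g' Gg']; first by exists g'.
by apply: Rfin; right.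
Qed.

(** * The extension step *)

(** A bare [Prop]-valued relation is carried instead of an order structure: stages are produced by
    recursion, and the initial poset may enter with its order reversed. *)
Record zposet := ZPoset {
  car :> Type;
  lt : car -> car -> Prop;
  zset : set car;
  lt_irr : forall p, ~ lt p p;
  lt_trans : forall p q r, lt p q -> lt q r -> lt p r;
  zset_down : forall p q, lt p q -> zset q -> zset p;
  zset_not_fin_gen : ~ fin_gen lt zset }.

Arguments lt {z}.
Arguments zset : clear implicits.

Section step.
Variable P : zposet.
Notation Z := (zset P).

Definition valid_cap (W : set P) :=
  (exists F, W = down lt F `|` Z) /\ ~ fin_gen lt W.

(* The condition [U p -> ~ Z p] keeps [Cut L U j] from lying below every
   [Cap (L `|` Z) i]; it costs nothing in the limit because the next [zset]
   contains no element above an old one. *)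
Definition valid_cut (L U : set P) :=
  [/\ fin_gen lt L, exists G, U = up lt G,
      forall l u, L l -> U u -> lt l u,
      forall p, U p -> ~ Z p & ~ fin_gen lt (L `|` Z)].

(* [Cap W i] sits above exactly [W] and below nothing; [Cut L U j] realizes the
   cut [(L, U)] and is marked by being below [Cap (L `|` Z) i] exactly for
   [i >= j]. The index sets are part of the data, so each type over [P] is
   realized once for each index. *)
Inductive new :=
| Cap (W : set P) (i : nat) of valid_cap W
| Cut (L U : set P) (j : nat) of valid_cut L U.

Definition below (v : new) : set P :=
  match v with Cap W _ _ => W | Cut L _ _ _ => L end.

Definition above (v : new) : set P :=
  match v with Cap _ _ _ => set0 | Cut _ U _ _ => U end.

Definition marks (v w : new) : Prop :=
  match v, w with
  | Cut L _ j _, Cap W i _ => W = L `|` Z /\ j <= i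
  | _, _ => False
  end.

(** Two new elements are comparable only through an old element between them or through a mark.
    Marks do not spoil transitivity: a marked cut has its lower part inside that of the cap, and
    nothing lies above a cap. *)
Definition step_lt (x y : P + new) : Prop :=
  match x, y with
  | inl p, inl q => lt p q
  | inl p, inr v => below v p
  | inr v, inl q => above v q
  | inr v, inr w => (exists2 p, above v p & below w p) \/ marks v w
  end.

(** These cuts form an infinite antichain of minimal elements, incomparable with every old
    element. *)
Definition step_zset (x : P + new) : Prop :=
  match x with
  | inr (Cut L U _ _) => L = set0 /\ U = set0
  | _ => False
  end.

Lemma fin_gen_closed (X : set P) p q : fin_gen lt X -> lt p q -> X q -> X p.
Proof.
by move=> [F ->] pq; apply: down_closed; [apply: lt_trans|right].
Qed.

Lemma below_closed v p q : lt p q -> below v q -> below v p.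
Proof.
case: v => [W i v|L U j v] pq /=; last first.
  by case: v => Lf _ _ _ _; apply: fin_gen_closed pq.
case: v => -[F ->] _; case=> [Fq|Zq]; last by right; apply: zset_down Zq.
by left; apply: fin_gen_closed pq Fq; exists F.
Qed.

Lemma above_closed v p q : lt p q -> above v p -> above v q.
Proof.
case: v => // L U j v pq /=; case: v => _ [G ->] _ _ _.
by apply: up_closed; [apply: lt_trans|right].
Qed.

Lemma below_above v p q : below v p -> above v q -> lt p q.
Proof. by case: v => // L U j [_ _ LU _ _] /=; apply: LU. Qed.

Lemma marks_below v w p : marks v w -> below v p -> below w p.
Proof.
by case: v => [//|L U j vv]; case: w => [W i vw|//] [/= -> _] Lp; left.
Qed.

Lemma marks_above v w q : marks v w -> ~ above w q.
Proof. by case: v => [//|L U j vv]; case: w => /= [? ? ? _ []|]. Qed.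

Lemma marks_marks u v w : marks u v -> ~ marks v w.
Proof. by case: u => [//|? ? ? ?]; case: v => /= [? ? ? _ []|]. Qed.

Lemma step_lt_irr x : ~ step_lt x x.
Proof.
case: x => [p|v] /=; first exact: lt_irr.
case=> [[p ap bp]|]; first by apply: (@lt_irr P p); apply: below_above bp ap.
by case: v.
Qed.

Lemma step_lt_trans x y z : step_lt x y -> step_lt y z -> step_lt x z.
Proof.
case: x y z => [p|u] [q|v] [r|w] //=.
- exact: lt_trans.
- exact: below_closed.
- exact: below_above.
- move=> vp [[q vq wq]|/marks_below]; last exact.
  by apply: below_closed wq; apply: below_above vp vq.
- by move=> uq qr; apply: above_closed uq.
- by move=> uq wq; left; exists q.
- move=> [[q uq vq]|uv vr]; last by case: (marks_above uv vr).
  by move=> vr; apply: above_closed uq; apply: below_above vq vr.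
- move=> [[p up vp]|uv]; last first.
    by case=> [[p /(marks_above uv)]//|/(marks_marks uv)].
  case=> [[q vq wq]|/marks_below /(_ vp)]; left; exists p => //.
  by apply: below_closed wq; apply: below_above vp vq.
Qed.

Lemma step_zset_down x y : step_lt x y -> step_zset y -> step_zset x.
Proof.
case: y => [//|[//|L U j v]] /= + [L0 U0]; case: x => [p|[W i vw|L' U' j' v']] /=.
- by rewrite L0.
- by case=> // -[].
- by case=> [[p _]|//]; rewrite L0.
Qed.

Lemma valid_cut0 : valid_cut set0 set0.
Proof.
split=> //; [by exists [::]; rewrite down_nil| by exists [::]; rewrite up_nil|].
by rewrite set0U; apply: zset_not_fin_gen.
Qed.

(** By pigeonhole one generator would dominate infinitely many [x j]; but an old element dominates
    none, [Cap W i] at most those with [j <= i], and a cut at most itself. The set [L] is arbitrary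
    so that the last clause of [valid_cut] holds for every cut over a stage of the form [step P]. *)
Lemma step_not_fin_gen L : ~ fin_gen step_lt (L `|` step_zset).
Proof.
move=> [F FE].
pose x j : P + new := inr (Cut j valid_cut0).
have [|//|f _] := @pigeonhole _ F [set: nat] (fun f j => le step_lt (x j) f).
- exact: infinite_nat.
- by move=> j _; have : down step_lt F (x j) by rewrite -FE; right.
case; case: f => [p|[W i v|L' U' j' v]].
- by apply: sub_finite_set (@finite_set0 nat) => j [].
- apply: sub_finite_set (finite_II i.+1) => j [//|/=].
  by case=> [[]//|[_]]; rewrite ltnS.
- apply: sub_finite_set (finite_set1 j') => j [[_ _ ->]//|/=].
  by case=> // -[].
Qed.

Definition step : zposet.
Proof.
apply: (@ZPoset _ step_lt step_zset step_lt_irr step_lt_trans step_zset_down).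
by rewrite -[step_zset]set0U; apply: step_not_fin_gen.
Defined.

End step.

(** * The limit of the iterated construction *)

Definition extension_property (T : Type) (lt : T -> T -> Prop) :=
  forall L U Y : seq T,
    (forall l u, In l L -> In u U -> lt l u) ->
    (forall y l, In y Y -> In l L -> ~ le lt y l) ->
    (forall y u, In y Y -> In u U -> ~ le lt u y) ->
    exists m, [/\ forall l, In l L -> lt l m, forall u, In u U -> lt m u &
      forall y, In y Y -> ~ le lt y m /\ ~ le lt m y].

Section tower.
Variable P0 : zposet.

Fixpoint stage n : zposet := if n is m.+1 then step (stage m) else P0.

(** A disjoint union of the initial poset and of the elements added at each stage: every element of
    the direct limit has one normal form, and no quotient is taken. *)
Definition limit := (P0 + {n & new (stage n)})%type.

Definition nu n (v : new (stage n)) : limit := inr (existT _ n v).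

Fixpoint iota n : stage n -> limit :=
  match n return stage n -> limit with
  | 0 => inl
  | m.+1 => fun t => match t with inl p => iota p | inr v => nu v end
  end.

Definition lim_lt (b c : limit) :=
  exists n (t u : stage n), [/\ iota t = b, iota u = c & lt t u].

Definition born n (b : limit) := exists t : stage n, iota t = b.

Local Notation "b <~ c" := (lim_lt b c) (at level 70).

Lemma iota_nu n (t : stage n) m (v : new (stage m)) : iota t = nu v -> m < n.
Proof.
elim: n t => [//|n IH] [p /IH /ltnW //|w].
by move/(congr1 (fun b => if b is inr (existT k _) then k else 0)) => /= ->.
Qed.

Lemma nu_inj n : injective (@nu n).
Proof.
by move=> v w [e]; apply: (@eq_from_Tagged nat (fun k => new (stage k))).
Qed.

Lemma iota_inj n : injective (@iota n).
Proof.
elim: n => [t u []//|n IH] [p|v] [q|w] //=.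
- by move/IH->.
- by move/iota_nu; rewrite ltnn.
- by move/esym/iota_nu; rewrite ltnn.
- by move/nu_inj->.
Qed.

Lemma lift2 n m (t u : stage n) : n <= m ->
  exists t' u' : stage m, [/\ iota t' = iota t, iota u' = iota u &
    lt t' u' <-> lt t u].
Proof.
elim: m => [|m IH]; first by case: n t u => // t u _; exists t, u.
rewrite leq_eqVlt => /orP [/eqP e|/IH [t' [u' [et eu tu]]]].
  by subst n; exists t, u.
by exists (inl t'), (inl u').
Qed.

Lemma lift n m (t : stage n) : n <= m -> exists t' : stage m, iota t' = iota t.
Proof. by move=> /(lift2 t t) [t' [_ [? _ _]]]; exists t'. Qed.

Lemma born_le n m b : n <= m -> born n b -> born m b.
Proof. by move=> nm [t <-]; apply: lift. Qed.

Lemma born_iota n (t : stage n) : born n (iota t).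
Proof. by exists t. Qed.

Lemma born_nu n (v : new (stage n)) : born n.+1 (nu v).
Proof. by exists (inr v). Qed.

Lemma not_born_nu n m (v : new (stage n)) : m <= n -> ~ born m (nu v).
Proof. by move=> mn [t /iota_nu]; rewrite ltnNge mn. Qed.

Lemma bornP b : exists n, born n b.
Proof. by case: b => [a|[n v]]; [exists 0, a|exists n.+1; apply: born_nu]. Qed.

Lemma not_born n b : ~ born n b -> exists2 m, n <= m & exists v : new (stage m), b = nu v.
Proof.
case: b => [a|[m v]] nb; first by case: nb; apply: (@born_le 0) => //; exists a.
exists m; last by exists v.
by rewrite leqNgt; apply/negP => mn; apply: nb; apply: born_le (born_nu v).
Qed.

Lemma lim_ltE n (t u : stage n) : iota t <~ iota u <-> lt t u.
Proof.
split=> [[m [t' [u' [et eu tu]]]]|]; last by exists n, t, u.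
have [t1 [u1 [et1 eu1 <-]]] := lift2 t u (leq_maxl n m).
have [t2 [u2 [et2 eu2 tu2]]] := lift2 t' u' (leq_maxr n m).
have -> : t1 = t2 by apply: iota_inj; rewrite et1 et2 et.
have -> : u1 = u2 by apply: iota_inj; rewrite eu1 eu2 eu.
exact/tu2.
Qed.

Lemma lt_old_new n (p : stage n) (v : new (stage n)) :
  iota p <~ nu v <-> below v p.
Proof. exact: (@lim_ltE n.+1 (inl p) (inr v)). Qed.

Lemma lt_new_old n (p : stage n) (v : new (stage n)) :
  nu v <~ iota p <-> above v p.
Proof. exact: (@lim_ltE n.+1 (inr v) (inl p)). Qed.

Lemma lt_new_new n (v w : new (stage n)) :
  nu v <~ nu w <-> (exists2 p, above v p & below w p) \/ marks v w.
Proof. exact: (@lim_ltE n.+1 (inr v) (inr w)). Qed.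

Lemma lim_leE n (t u : stage n) : le lim_lt (iota t) (iota u) <-> le lt t u.
Proof.
split=> -[e|]; try by [left; apply: iota_inj|left; rewrite e].
- by move/lim_ltE; right.
- by move=> tu; right; apply/lim_ltE.
Qed.

Lemma lim_lt_irr b : ~ b <~ b.
Proof. by have [n [t <-]] := bornP b; move/lim_ltE; apply: lt_irr. Qed.

Lemma lim_lt_trans b c d : b <~ c -> c <~ d -> b <~ d.
Proof.
have [n1 bn] := bornP b; have [n2 cn] := bornP c; have [n3 dn] := bornP d.
pose n := maxn (maxn n1 n2) n3.
have [t <-] : born n b by apply: born_le bn; rewrite !leq_max leqnn.
have [u <-] : born n c by apply: born_le cn; rewrite !leq_max leqnn orbT.
have [r <-] : born n d by apply: born_le dn; rewrite !leq_max leqnn orbT.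
by move=> /lim_ltE tu /lim_ltE ur; apply/lim_ltE; apply: lt_trans ur.
Qed.

Lemma born_seq (s : seq limit) : exists n, forall b, In b s -> born n b.
Proof.
elim: s => [|b s [n IH]]; first by exists 0.
have [m bm] := bornP b; exists (maxn m n) => c [<-|/IH].
  by apply: born_le bm; apply: leq_maxl.
by apply: born_le; apply: leq_maxr.
Qed.

Lemma lift_seq n (s : seq limit) : (forall b, In b s -> born n b) ->
  exists s' : seq (stage n), [seq iota t | t <- s'] = s.
Proof.
elim: s => [|b s IH] sn; first by exists [::].
have [|s' <-] := IH; first by move=> c sc; apply: sn; right.
by have [|t <-] := sn b; [left|exists (t :: s')].
Qed.

(** The finite data live in some stage [n], but the cut is made over stage [n.+1]: there the upper
    side, generated by elements of stage [n], avoids [zset], and [step_not_fin_gen] supplies the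
    last clause of [valid_cut]. *)
Lemma limit_extension : extension_property lim_lt.
Proof.
move=> L U Y LU YL YU.
have [n LUYn] := born_seq (app L (app U Y)).
have [L' LE] : exists s' : seq (stage n), [seq iota t | t <- s'] = L.
  by apply: lift_seq => b ?; apply: LUYn; apply/List.in_app_iff; left.
have [U' UE] : exists s' : seq (stage n), [seq iota t | t <- s'] = U.
  apply: lift_seq => b ?; apply: LUYn; apply/List.in_app_iff; right.
  by apply/List.in_app_iff; left.
have Yn y : In y Y -> born n y.
  move=> ?; apply: LUYn; apply/List.in_app_iff; right.
  by apply/List.in_app_iff; right.
pose inlL : seq (stage n.+1) := [seq inl l | l <- L'].
pose inlU : seq (stage n.+1) := [seq inl u | u <- U'].
have inL l : In l L -> exists2 t, In t inlL & iota t = l.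
  by rewrite -LE => /in_map [t tL ->]; exists (inl t) => //; apply/in_map; exists t.
have inU l : In l U -> exists2 t, In t inlU & iota t = l.
  by rewrite -UE => /in_map [t tL ->]; exists (inl t) => //; apply/in_map; exists t.
have Lin t : In t inlL -> In (iota t) L.
  by case/in_map => l ? ->; rewrite -LE; apply/in_map; exists l.
have Uin t : In t inlU -> In (iota t) U.
  by case/in_map => l ? ->; rewrite -UE; apply/in_map; exists l.
have v : valid_cut (down lt inlL) (up lt inlU).
  split; [by exists inlL|by exists inlU| | |exact: step_not_fin_gen].
  - move=> l u [f Lf lf] [g Ug gu].
    apply: le_lt_trans lf _; first exact: lt_trans.
    apply: lt_le_trans gu; first exact: lt_trans.
    by apply/lim_ltE; apply: LU; [apply: Lin|apply: Uin].
  (* A member of the next [zset] has an empty lower part, so it cannot be above the old element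
     [u]. *)
  - move=> p [g /in_map [u _ ->]] [<- []|]; case: p => [p _ []|[W i v1 _ []|L1 U1 j v1]] /=.
    by move=> + [L10 _]; rewrite L10.
exists (nu (Cut 0 v)); split.
- by move=> l /inL [t tL <-]; apply/lt_old_new; apply: in_down.
- by move=> u /inU [t tU <-]; apply/lt_new_old; apply: in_up.
move=> y Yy; have yn := Yn _ Yy.
have yn1 : born n.+1 y by apply: born_le yn.
split=> -[e|].
- by apply: (@not_born_nu n.+1 n.+1 (Cut 0 v)) => //; rewrite -e.
- case: yn1 => t et; rewrite -et => /lt_old_new [f /Lin Lf].
  by move/lim_leE; rewrite et; apply: YL.
- by apply: (@not_born_nu n.+1 n.+1 (Cut 0 v)) => //; rewrite e.
- case: yn1 => t et; rewrite -et => /lt_new_old [f /Uin Uf].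
  by move/lim_leE; rewrite et; apply: YU.
Qed.

Lemma interpolate (F : seq limit) z : (forall f, In f F -> f <~ z) ->
  exists2 y, y <~ z & forall f, In f F -> f <~ y.
Proof.
move=> Fz; have [|//|//|y [Fy yz _]] := @limit_extension F [:: z] [::].
  by move=> l u /Fz lz [<-|[]].
by exists y => //; apply: yz; left.
Qed.

(** * Rigidity: recognizing the caps of a stage *)

Lemma cap_maximal n W i (v : valid_cap W) c :
  born n.+1 c -> ~ nu (Cap i v : new (stage n)) <~ c.
Proof.
case=> -[p|w] <-; first by move/lt_new_old.
by move/lt_new_new => -[[]|].
Qed.

Section cap_minimal.
Variables (n : nat) (W : set (stage n)) (i : nat) (v : valid_cap W).

Definition generated_in (w : limit) := exists2 F : seq (stage n),
  (forall f, In f F -> W f) &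
  forall p : stage n, le lim_lt (iota p) w -> down lt F p.

Lemma generated_in_seq (s : seq limit) :
  (forall w, In w s -> generated_in w) ->
  exists2 F : seq (stage n), (forall f, In f F -> W f) &
    forall w (p : stage n), In w s -> le lim_lt (iota p) w -> down lt F p.
Proof.
elim: s => [|w s IH] sg; first by exists [::].
have [|F FW Fs] := IH; first by move=> ? ?; apply: sg; right.
have [|F' F'W F's] := sg w; first by left.
exists (app F F') => [f /List.in_app_iff [/FW|/F'W]//|w' p].
by rewrite down_app => -[<- /F's|ws /(Fs _ _ ws)]; [right|left].
Qed.

(* Everything added after stage [n] below a cap is a cut with finitely
   generated lower part, so it sees only a finitely generated part of [W]. *)
Lemma below_cap_generated w : w <~ nu (Cap i v) -> generated_in w.
Proof.
have [m] := bornP w; elim/ltn_ind: m w => m IH w wm ws.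
have [[q qw]|/not_born [k nk [u wE]]] := pselect (born n w).
  exists [:: q] => [f [<-|//]|p]; first by apply/(lt_old_new q (Cap i v)); rewrite qw.
  by rewrite -qw => /lim_leE; exists q => //; left.
have km : k < m by rewrite ltnNge; apply/negP => mk; apply: (@not_born_nu k m u) => //; rewrite -wE.
case: u wE => [W' i' v'|L U j v'] wE.
  by move: ws; rewrite wE => /cap_maximal []; apply: born_le (born_nu _); rewrite ltnS.
have [[F LF] _ _ _ _] := v'.
have Fw f : In f F -> iota f <~ w.
  by move=> Ff; rewrite wE; apply/lt_old_new; rewrite /= LF; apply: in_down.
have [|G GW GF] := @generated_in_seq [seq iota f | f <- F].
  move=> _ /in_map [f Ff ->]; apply: (IH k) => //; first exact: born_iota.
  by apply: lim_lt_trans ws; apply: Fw.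
exists G => // p; rewrite wE => -[e|].
  by case: (@not_born_nu _ _ (Cut j v') nk); exists p.
have [p' pE] := lift p nk; rewrite -pE => /lt_old_new /=; rewrite LF.
move=> [f Ff /lim_leE]; rewrite pE; apply: GF; apply/in_map; by exists f.
Qed.

(** If [w] bounded [zset], then [zset] would lie in a finitely generated part of [W]; together with
    the generators [F1] of the rest, this would make [W] finitely generated. *)
Lemma cap_minimal w : w <~ nu (Cap i v) ->
  ~ forall p, zset (stage n) p -> iota p <~ w.
Proof.
move=> /below_cap_generated [F FW Fw] Zw; have [[F1 WE] []] := v.
exists (app F1 F); rewrite down_app; apply/predeqP => p; split.
  by rewrite WE => -[|/Zw pw]; [left|right; apply: Fw; right].
case=> [|[f /FW Wf [->//|pf]]]; first by rewrite WE; left.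
by apply: (@below_closed _ (Cap i v)) pf Wf.
Qed.

End cap_minimal.

Lemma lift_zset n m (p : stage n) : n < m ->
  exists2 p' : stage m, iota p' = iota p & ~ zset (stage m) p'.
Proof.
case: m => // m nm; have [p' pE] := @lift n m p nm.
by exists (inl p') => // -[].
Qed.

(* An element whose part of [zset] is finitely generated can be undercut by
   density; only caps of stage [n] escape this. *)
Lemma minimal_is_cap n z : ~ born n z ->
  (forall p, zset (stage n) p -> iota p <~ z) ->
  (forall y, y <~ z -> ~ forall p, zset (stage n) p -> iota p <~ y) ->
  exists W i (v : valid_cap W), z = nu (Cap i v : new (stage n)).
Proof.
move=> /not_born [m nm [v zE]] Zz zmin; apply: contrapT => ncap.
(* Finitely many elements below [z] that generate a set containing [zset] of stage [n] contradict
   minimality: interpolating between them and [z] gives a smaller upper bound. *)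
suff [F Fv FZ] : exists2 F : seq (stage m), (forall f, In f F -> below v f) &
    forall p, zset (stage n) p -> exists2 p', iota p' = iota p & down lt F p'.
  have [|y yz Fy] := @interpolate [seq iota f | f <- F] z.
    by move=> _ /in_map [f /Fv vf ->]; rewrite zE; apply/lt_old_new.
  apply: (zmin y yz) => p /FZ [p' <- [f Ff /lim_leE pf]].
  by apply: le_lt_trans lim_lt_trans _ _ _ pf _; apply: Fy; apply/in_map; exists f.
case: v zE => [W i v|L U j v] zE; last first.
  have [[F LF] _ _ _ _] := v; exists F => [f /=|p Zp].
    by rewrite LF; apply: in_down.
  have [p' pE] := lift p nm; exists p' => //.
  by rewrite -LF; apply/(lt_old_new p' (Cut j v)); rewrite pE -zE; apply: Zz.
(* For a cap of a later stage the part of [W] inside [zset] contains no lifted element, so the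
   generators of the remaining part suffice. *)
case: (ltngtP n m) nm => // [nm _|nm _]; last first.
  by subst m; case: ncap; exists W, i, v.
have [[F WF] _] := v; exists F => [f /=|p Zp].
  by rewrite WF; left; apply: in_down.
have [p' pE Zp'] := lift_zset p nm; exists p' => //.
have : W p' by apply/(lt_old_new p' (Cap i v)); rewrite pE -zE; apply: Zz.
by rewrite WF => -[].
Qed.

Section stage_fixed.
Variable n : nat.

Definition fixes (g : limit -> limit) := forall t : stage n, g (iota t) = iota t.

Lemma fixes_sym g g' : order_aut lim_lt g g' -> fixes g -> fixes g'.
Proof. by case=> gK _ _ gf t; rewrite -{1}(gf t) gK. Qed.

Lemma fixes_born g g' b : order_aut lim_lt g g' -> fixes g -> born n (g b) -> born n b.
Proof.
by case=> gK _ _ gf [t tE]; exists t; apply: (can_inj gK); rewrite gf tE.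
Qed.

(** Being a minimal upper bound of [zset] outside stage [n] is invariant under [g], and so is the
    set of elements of stage [n] below; only the index is left undetermined. *)
Lemma fixes_cap g g' W i (v : valid_cap W) : order_aut lim_lt g g' -> fixes g ->
  exists i', g (nu (Cap i v : new (stage n))) = nu (Cap i' v : new (stage n)).
Proof.
move=> ga gf; have [gK g'K gE] := ga; have g'f := fixes_sym ga gf.
set z := g _.
have zP p : iota p <~ z <-> W p.
  by rewrite -(gf p) gE; apply: (lt_old_new p (Cap i v)).
have [|p Zp|y yz Zy|W' [i' [v' zE]]] := @minimal_is_cap n z.
- by move=> /(fixes_born ga gf); apply: not_born_nu.
- by apply/zP; case: v {z zP} => -[F ->] _; right.
- apply: (@cap_minimal n W i v (g' y)).
    by rewrite -gE g'K.
  by move=> p /Zy py; rewrite -gE g'K gf.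
have WW' : W' = W.
  by apply/predeqP => p; rewrite -zP zE; symmetry; apply: (lt_old_new p (Cap i' v')).
by subst W'; exists i'; rewrite zE (Prop_irrelevance v' v).
Qed.

(** * Rigidity: recognizing the cuts and their indices *)

Section cap_sequence.
Variables (W : set (stage n)) (v : valid_cap W).

Definition cap i := nu (Cap i v : new (stage n)).

(* Infinitely many caps rather than cofinitely many: this form is visibly
   invariant under permutations of the caps. *)
Definition eventually_below (z : limit) := infinite_set [set i | z <~ cap i].

Lemma cap_inj : injective cap.
Proof. by move=> i i' /nu_inj []. Qed.

Lemma below_capP p i : iota p <~ cap i <-> W p.
Proof. exact: lt_old_new. Qed.

(** Induction on the stage where [z] appears. A later cap is never below a cap of stage [n]. A later
    cut has a finitely generated upper part, so by pigeonhole one of its generators, which appears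
    earlier, is below infinitely many caps. *)
Lemma eventually_below_bounded z : eventually_below z ->
  exists y, [/\ born n.+1 y, le lim_lt z y & eventually_below y].
Proof.
have [m] := bornP z; elim/ltn_ind: m z => m IH z zm zinf.
have [zn|/not_born [k nk [u zE]]] := pselect (born n.+1 z).
  by exists z; split => //; left.
have km : k < m.
  by rewrite ltnNge; apply/negP => mk; apply: (not_born_nu (v := u) mk); rewrite -zE.
have capk i : born k (cap i) by apply: born_le nk _; apply: born_nu.
case: u zE => [W' i' v'|L U j v'] zE.
  case: zinf; apply: sub_finite_set (@finite_set0 nat) => i.
  rewrite /= zE => /cap_maximal []; exact: born_le (capk i).
have [_ [G UG] _ _ _] := v'.
have zU g : U g -> z <~ iota g by move=> Ug; rewrite zE; apply/lt_new_old.
have [i zi|g Gg gi] := @pigeonhole _ G _ (fun g => [set i | le lim_lt (iota g) (cap i)]) zinf.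
  have [t tE] := capk i; move: zi; rewrite /= zE -tE => /lt_new_old.
  by rewrite /= UG => -[g Gg gt]; exists g => //; apply/lim_leE.
have gU : U g by rewrite UG; apply: in_up.
have [||y [yn gy yi]] := IH k km (iota g); [exact: born_iota| |].
  move=> fin; apply: gi.
  (* Since [cap] is injective, [iota g] equals at most one cap, so passing from [le] to the strict
     order loses at most one index. *)
  apply: (@sub_finite_set _ _ ([set i | iota g <~ cap i] `|` [set i | iota g = cap i])).
    by move=> i [|]; [right|left].
  rewrite finite_setU; split=> //.
  have [[i0 e0]|ne] := pselect (exists i, iota g = cap i).
    by apply: sub_finite_set (finite_set1 i0) => i; rewrite /= e0 => /cap_inj ->.
  by apply: sub_finite_set (@finite_set0 nat) => i e; case: ne; exists i.
by exists y; split=> //; right; apply: lt_le_trans gy; [apply: lim_lt_trans|apply: zU].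
Qed.

Lemma aut_cap_index g g' : order_aut lim_lt g g' -> fixes g ->
  exists2 s : nat -> nat, injective s & forall i, g (cap i) = cap (s i).
Proof.
move=> ga gf; have /choice [s sE] := fun i => fixes_cap i v ga gf.
exists s => // i i' e; apply: cap_inj.
by case: ga => gK _ _; apply: (can_inj gK); rewrite /cap !sE e.
Qed.

Lemma aut_eventually_below g g' z : order_aut lim_lt g g' -> fixes g ->
  eventually_below z -> eventually_below (g z).
Proof.
move=> ga gf zi fin; have [s sI sE] := aut_cap_index ga gf; apply: zi.
have -> : [set i | z <~ cap i] = s @^-1` [set i | g z <~ cap i].
  by apply/predeqP => i; case: ga => _ _ gE; rewrite /= -sE gE.
by apply: finite_preimage fin => ? ? _ _; apply: sI.
Qed.

End cap_sequence.

Lemma valid_cut_cap (L U : set (stage n)) :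
  valid_cut L U -> valid_cap (L `|` zset (stage n)).
Proof. by case=> -[F LF] _ _ _ nfg; split=> //; exists F; rewrite LF. Qed.

Section cut_fixed.
Variables (L U : set (stage n)) (v : valid_cut L U).
Let W := valid_cut_cap v.
Let x j := nu (Cut j v : new (stage n)).

(** No old element lies between the two: [U] is disjoint from [Z] by validity and from [L] by
    irreflexivity. Only the mark remains. *)
Lemma cut_lt_cap i j : x j <~ cap W i <-> j <= i.
Proof.
have [_ _ LU UZ _] := v; rewrite lt_new_new /=; split; last by right.
case=> [[p Up [Lp|Zp]]|[]//]; last by case: (UZ p).
by case: (@lt_irr (stage n) p); apply: LU.
Qed.

Lemma cut_eventually_below j : eventually_below W (x j).
Proof.
move=> fin; apply: infinite_nat.
apply: sub_finite_set (_ : finite_set (`I_j `|` [set i | x j <~ cap W i])).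
  by move=> i _; have [ij|ji] := ltnP i j; [left|right; apply/cut_lt_cap].
by rewrite finite_setU; split=> //; apply: finite_II.
Qed.

(** One may take [y] in stage [n.+1]. An old element above [x j] is in [U], which misses the lower
    set of the caps; a new one is either above an element of [U], which is excluded likewise, or a
    cap, hence maximal in that stage. *)
Lemma cut_maximal j y : x j <~ y -> ~ eventually_below W y.
Proof.
move=> xy /eventually_below_bounded [y' [yn yy' y'i]].
have {xy yy'} xy' : x j <~ y' by apply: lt_le_trans yy'; [apply: lim_lt_trans|].
have [i y'W] : exists i, y' <~ cap W i.
  by have /infinite_setN0 [i] := y'i; exists i.
have [_ _ LU UZ _] := v.
have UW p : U p -> ~ (L `|` zset (stage n)) p.
  by move=> Up [Lp|]; [apply: (@lt_irr (stage n) p); apply: LU|apply: UZ].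
case: yn xy' y'W => -[p|w] <- /=.
  by move=> /lt_new_old /= /UW Wp /below_capP.
move=> /lt_new_new [[p /= /UW Wp wp]|xw] wW.
  by apply/Wp/(below_capP W p i); apply: lim_lt_trans wW; apply/lt_old_new.
by case: w xw wW => //= ? ? ? _ /cap_maximal []; apply: born_nu.
Qed.

Lemma aut_cut_index g g' : order_aut lim_lt g g' -> fixes g -> forall j, exists j', g (x j) = x j'.
Proof.
move=> ga gf j; have [gK g'K gE] := ga; have g'f := fixes_sym ga gf.
have ga' := order_aut_sym ga.
have zi : eventually_below W (g (x j)).
  by apply: aut_eventually_below ga gf _; apply: cut_eventually_below.
have zn : ~ born n (g (x j)).
  by move=> /(fixes_born ga gf); apply: not_born_nu.
have : born n.+1 (g (x j)).
  (* A strict bound [y] pulled back by [g'] would contradict the maximality of [x j]. *)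
  have [y [yn [->//|zy] yi]] := eventually_below_bounded zi.
  case: (@cut_maximal j (g' y)); first by rewrite -gE g'K.
  exact: aut_eventually_below ga' g'f yi.
case=> -[p|[W' i v'|L' U' j' v']] zE; first by case: zn; exists p.
  have {}zE : nu (Cap i v' : new (stage n)) = g (x j) := zE.
  have [i' /esym] := fixes_cap i v' ga' g'f.
  by rewrite zE gK => /nu_inj.
have {}zE : nu (Cut j' v' : new (stage n)) = g (x j) := zE.
have LL' : L' = L.
  apply/predeqP => p; rewrite -[L' p]/(below (Cut j' v') p) -lt_old_new zE.
  by rewrite -(gf p) gE lt_old_new.
have UU' : U' = U.
  apply/predeqP => p; rewrite -[U' p]/(above (Cut j' v') p) -lt_new_old zE.
  by rewrite -(gf p) gE lt_new_old.
by subst L' U'; exists j'; rewrite -zE (Prop_irrelevance v' v).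
Qed.

(** The index [j] counts the caps not above [x j]. The injection [s] induced by [g] maps the indices
    below [j] into those below [j'], so cardinalities compare. *)
Lemma aut_cut_le g g' j j' : order_aut lim_lt g g' -> fixes g -> g (x j) = x j' -> j <= j'.
Proof.
move=> ga gf xE; have [s sI sE] := aut_cap_index W ga gf.
have slt i : i < j -> s i < j'.
  rewrite !ltnNge => ij; apply: contra ij => /(@cut_lt_cap _ j').
  by case: ga => _ _ gE; rewrite -xE -sE gE => /cut_lt_cap.
pose f (i : 'I_j) := Ordinal (slt i (ltn_ord i)).
have /leq_card : injective f by move=> i k [] /sI /val_inj.
by rewrite !card_ord.
Qed.

Lemma aut_cut g g' j : order_aut lim_lt g g' -> fixes g -> g (x j) = x j.
Proof.
move=> ga gf; have [j' xE] := aut_cut_index ga gf j; rewrite xE; congr x.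
apply/eqP; rewrite eqn_leq (aut_cut_le ga gf xE) andbT.
apply: (aut_cut_le (order_aut_sym ga) (fixes_sym ga gf)).
by rewrite -xE; case: ga.
Qed.

End cut_fixed.

(** The index [i] is the largest [j] such that the cut with lower part [down lt F], empty upper part
    and index [j] is below the cap; those cuts are already fixed. *)
Lemma aut_cap g g' W i (v : valid_cap W) : order_aut lim_lt g g' -> fixes g ->
  g (nu (Cap i v : new (stage n))) = nu (Cap i v : new (stage n)).
Proof.
move=> ga gf; have [i' sE] := fixes_cap i v ga gf; rewrite sE.
have [[F WF] nfg] := v.
have v0 : valid_cut (down lt F) set0.
  split=> //; [by exists F|by exists [::]; rewrite up_nil|by rewrite -WF].
subst W; rewrite (Prop_irrelevance v (valid_cut_cap v0)) in sE *.
have ii' j : j <= i' <-> j <= i.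
  have [_ _ gE] := ga.
  by rewrite -!(cut_lt_cap v0) /cap -sE -{1}(aut_cut v0 j ga gf) gE.
congr (nu (Cap _ _)); apply/eqP; rewrite eqn_leq.
by apply/andP; split; apply/ii'.
Qed.

End stage_fixed.

Theorem limit_rigid g g' : order_aut lim_lt g g' -> (forall a, g (inl a) = inl a) ->
  forall b, g b = b.
Proof.
move=> ga g0 b; have [n [t <-]] := bornP b.
elim: n t {b} => [//|n IH] [p|[W i v|L U j v]] /=; first exact: IH.
- exact: aut_cap ga IH.
- exact: aut_cut ga IH.
Qed.

End tower.

(** * Extension of automorphisms *)

(** The inverse is data because [W \o bwd a], the image of [W] under [fwd a], defines the action on
    new elements. *)
Record zaut (P : zposet) := ZAut {
  fwd : P -> P;
  bwd : P -> P;
  fwdK : cancel fwd bwd;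
  bwdK : cancel bwd fwd;
  fwd_lt : forall p q, lt (fwd p) (fwd q) <-> lt p q;
  fwd_zset : forall p, zset P (fwd p) <-> zset P p }.

Section zaut_step.
Variable P : zposet.
Implicit Types a : zaut P.

Lemma bwd_lt a p q : lt (bwd a p) (bwd a q) <-> lt p q.
Proof. by rewrite -(fwd_lt a) !bwdK. Qed.

Lemma bwd_zset a p : zset P (bwd a p) <-> zset P p.
Proof. by rewrite -(fwd_zset a) bwdK. Qed.

Definition zaut_inv a : zaut P :=
  ZAut (bwdK a) (fwdK a) (bwd_lt a) (bwd_zset a).

Lemma zaut_invK : involutive zaut_inv.
Proof.
by case=> f f' fK f'K flt fz; rewrite /zaut_inv /=; congr ZAut;
  apply: Prop_irrelevance.
Qed.

Lemma le_bwd a p q : le lt (bwd a p) q <-> le lt p (fwd a q).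
Proof.
split=> -[e|pq].
- by left; rewrite -e bwdK.
- by right; rewrite -(bwd_lt a) fwdK.
- by left; rewrite e fwdK.
- by right; rewrite -(fwd_lt a) bwdK.
Qed.

Lemma le_fwd a p q : le lt p (bwd a q) <-> le lt (fwd a p) q.
Proof. exact: iff_sym (le_bwd (zaut_inv a) p q). Qed.

Lemma down_comp a F : down lt F \o bwd a = down lt [seq fwd a f | f <- F].
Proof.
apply/predeqP => p; split=> [[f Ff /le_bwd pf]|[_ /in_map [f Ff ->] pf]].
  by exists (fwd a f) => //; apply/in_map; exists f.
by exists f => //; apply/le_bwd.
Qed.

Lemma up_comp a F : up lt F \o bwd a = up lt [seq fwd a f | f <- F].
Proof.
apply/predeqP => p; split=> [[f Ff /le_fwd pf]|[_ /in_map [f Ff ->] pf]].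
  by exists (fwd a f) => //; apply/in_map; exists f.
by exists f => //; apply/le_fwd.
Qed.

Lemma zset_comp a : zset P \o bwd a = zset P.
Proof. by apply/predeqP => p; apply: bwd_zset. Qed.

Lemma comp_bwdK a (X : set P) : (X \o bwd a) \o fwd a = X.
Proof. by apply/funext => p /=; rewrite fwdK. Qed.

Lemma fin_gen_comp a X : fin_gen lt (X \o bwd a) <-> fin_gen lt X.
Proof.
split=> [[F XF]|[F ->]]; last by exists [seq fwd a f | f <- F]; apply: down_comp.
exists [seq bwd a f | f <- F]; rewrite -(comp_bwdK a X) XF.
exact: (down_comp (zaut_inv a)).
Qed.

Lemma valid_cap_comp a W : valid_cap W -> valid_cap (W \o bwd a).
Proof.
case=> -[F WF] nfg; split; last by rewrite fin_gen_comp.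
exists [seq fwd a f | f <- F]; rewrite WF -down_comp -[in RHS](zset_comp a).
by [].
Qed.

Lemma valid_cut_comp a L U : valid_cut L U -> valid_cut (L \o bwd a) (U \o bwd a).
Proof.
case=> Lf [G UG] LU UZ nfg; split.
- by rewrite fin_gen_comp.
- by exists [seq fwd a f | f <- G]; rewrite UG up_comp.
- by move=> l u Ll Uu; rewrite -(bwd_lt a); apply: LU.
- by move=> p Up; rewrite -(bwd_zset a); apply: UZ.
- by rewrite -(zset_comp a); apply: contra_not nfg => /(fin_gen_comp a (L `|` zset P)).
Qed.

Definition new_map a (v : new P) : new P :=
  match v with
  | Cap W i v => Cap i (valid_cap_comp a v)
  | Cut L U j v => Cut j (valid_cut_comp a v)
  end.

Lemma new_mapK a : cancel (new_map a) (new_map (zaut_inv a)).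
Proof.
case=> [W i v|L U j v] /=.
  (* The validity proof is generalized so that the set in its type can be rewritten; proof
     irrelevance then identifies it with [v]. *)
  set v' := valid_cap_comp _ _; move: v'; rewrite /= comp_bwdK => v'.
  by rewrite (Prop_irrelevance v' v).
set v' := valid_cut_comp _ _; move: v'; rewrite /= !comp_bwdK => v'.
by rewrite (Prop_irrelevance v' v).
Qed.

Definition step_map a (x : step P) : step P :=
  match x with inl p => inl (fwd a p) | inr v => inr (new_map a v) end.

Lemma step_mapK a : cancel (step_map a) (step_map (zaut_inv a)).
Proof. by case=> [p|v] /=; rewrite ?fwdK ?new_mapK. Qed.

Lemma below_new_map a v p : below (new_map a v) p <-> below v (bwd a p).
Proof. by case: v. Qed.

Lemma above_new_map a v p : above (new_map a v) p <-> above v (bwd a p).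
Proof. by case: v. Qed.

Lemma marks_new_map a v w : marks v w -> marks (new_map a v) (new_map a w).
Proof.
case: v w => [//|L U j v] [W i w|//] /= [WL ji]; split=> //.
by rewrite WL -[in RHS](zset_comp a).
Qed.

Lemma step_map_homo a x y : lt x y -> lt (step_map a x) (step_map a y).
Proof.
case: x y => [p|v] [q|w] //=.
- by move/fwd_lt.
- by rewrite below_new_map fwdK.
- by rewrite above_new_map fwdK.
- case=> [[p vp wp]|/(marks_new_map a)]; last by right.
  by left; exists (fwd a p); rewrite ?below_new_map ?above_new_map fwdK.
Qed.

Lemma step_zset_map a x : zset (step P) x -> zset (step P) (step_map a x).
Proof. by case: x => [p|[W i v|L U j v]] //= [-> ->]. Qed.

Definition step_aut a : zaut (step P).
Proof.
apply: (@ZAut _ (step_map a) (step_map (zaut_inv a))).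
- exact: step_mapK.
- by move=> x; have := step_mapK (zaut_inv a) x; rewrite zaut_invK.
- move=> x y; split; last exact: step_map_homo.
  by move/(step_map_homo (zaut_inv a)); rewrite !step_mapK.
- move=> x; split; last exact: step_zset_map.
  by move/(step_zset_map (zaut_inv a)); rewrite step_mapK.
Defined.

End zaut_step.

Section limit_map.
Variables (P0 : zposet) (a : zaut P0).

Fixpoint stage_aut n : zaut (stage P0 n) :=
  if n is m.+1 then step_aut (stage_aut m) else a.

Definition limit_map (b : limit P0) : limit P0 :=
  match b with
  | inl p => inl (fwd a p)
  | inr (existT n v) => nu (new_map (stage_aut n) v)
  end.

Definition limit_map_inv (b : limit P0) : limit P0 :=
  match b with
  | inl p => inl (bwd a p)
  | inr (existT n v) => nu (new_map (zaut_inv (stage_aut n)) v)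
  end.

Lemma limit_map_iota n (t : stage P0 n) :
  limit_map (iota t) = iota (fwd (stage_aut n) t).
Proof. by elim: n t => [//|n IH] [p|v] //=. Qed.

Lemma limit_map_inv_iota n (t : stage P0 n) :
  limit_map_inv (iota t) = iota (bwd (stage_aut n) t).
Proof. by elim: n t => [//|n IH] [p|v] //=. Qed.

Lemma limit_map_aut : order_aut (@lim_lt P0) limit_map limit_map_inv.
Proof.
split.
- by move=> b; have [n [t <-]] := bornP b; rewrite limit_map_iota limit_map_inv_iota fwdK.
- by move=> b; have [n [t <-]] := bornP b; rewrite limit_map_inv_iota limit_map_iota bwdK.
move=> b c; have [n bn] := bornP b; have [m cm] := bornP c.
have [t <-] : born (maxn n m) b by apply: born_le bn; apply: leq_maxl.
have [u <-] : born (maxn n m) c by apply: born_le cm; apply: leq_maxr.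
by rewrite !limit_map_iota !lim_ltE fwd_lt.
Qed.

End limit_map.

(** * Countability *)

Definition injects_nat (T : Type) := exists f : T -> nat, injective f.

Lemma injects_nat_image (S T : Type) (R : S -> T -> Prop) :
  injects_nat S -> (forall t, exists s, R s t) ->
  (forall s t t', R s t -> R s t' -> t = t') -> injects_nat T.
Proof.
move=> [f fI] /choice [h hR] Rfun; exists (f \o h) => t t' /= /fI e.
by apply: (Rfun (h t)) => //; rewrite e.
Qed.

(** A new element is coded by finite generating sequences and an index; its validity proof adds
    nothing by proof irrelevance. *)
Lemma injects_nat_new (P : zposet) : injects_nat P -> injects_nat (new P).
Proof.
move=> [f fI].
pose S := (seq P * nat + seq P * seq P * nat)%type.
pose R (s : S) (v : new P) :=
  match s, v with
  | inl (F, i), Cap W i' _ => W = down lt F `|` zset P /\ i' = i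
  | inr (F, G, j), Cut L U j' _ => [/\ L = down lt F, U = up lt G & j' = j]
  | _, _ => False
  end.
apply: (@injects_nat_image S _ R).
- pose h (s : S) : (seq nat * nat + seq nat * seq nat * nat)%type :=
    match s with
    | inl (F, i) => inl (map f F, i)
    | inr (F, G, j) => inr (map f F, map f G, j)
    end.
  exists (pickle \o h) => s t /= /(pcan_inj pickleK).
  by case: s t => [[F i]|[[F G] j]] [[F' i']|[[F' G'] j']] //= [];
    [move=> /(inj_map fI) -> ->|move=> /(inj_map fI) -> /(inj_map fI) -> ->].
- case=> [W i v|L U j v].
    by have [[F WF] _] := v; exists (inl (F, i)).
  by have [[F LF] [G UG] _ _ _] := v; exists (inr (F, G, j)).
- case=> [[F i]|[[F G] j]] [W i1 v|L U j1 v] [W' i2 v'|L' U' j2 v'] //=.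
    by move=> [? ?] [? ?]; subst; rewrite (Prop_irrelevance v v').
  by move=> [? ? ?] [? ? ?]; subst; rewrite (Prop_irrelevance v v').
Qed.

Lemma injects_nat_sum (S T : Type) :
  injects_nat S -> injects_nat T -> injects_nat (S + T).
Proof.
move=> [f fI] [g gI].
exists (fun x => pickle (match x with inl s => inl (f s) | inr t => inr (g t) end)).
by move=> [s|t] [s'|t'] /(pcan_inj pickleK) [] // => [/fI|/gI] ->.
Qed.

Lemma injects_nat_stage (P0 : zposet) n : injects_nat P0 -> injects_nat (stage P0 n).
Proof.
by move=> P0c; elim: n => // n IH; apply: injects_nat_sum (injects_nat_new IH).
Qed.

Lemma injects_nat_limit (P0 : zposet) : injects_nat P0 -> injects_nat (limit P0).
Proof.
move=> P0c; apply: injects_nat_sum => //.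
have /choice [f fI] : forall n, exists f : limit P0 -> nat,
    injective (f \o @nu P0 n).
  move=> n; have [f fI] := injects_nat_new (injects_nat_stage n P0c).
  have /choice [h hE] : forall b : limit P0, exists k : nat,
      forall v : new (stage P0 n), b = nu v -> k = f v.
    move=> b; have [[v ->]|nb] := pselect (exists v : new (stage P0 n), b = nu v).
      by exists (f v) => w /nu_inj ->.
    (* Default code for elements not added at stage [n]; injectivity is required only along [nu]. *)
    by exists 0 => v e; case: nb; exists v.
  by exists h => v w /=; rewrite (hE _ v erefl) (hE _ w erefl) => /fI.
exists (fun x => pickle (tag x, f (tag x) (nu (tagged x)))).
move=> [n v] [m w] /(pcan_inj pickleK) [/= nm]; subst m.
by move/fI ->.
Qed.

Lemma in_sub (T : Type) (Q : T -> Prop) (s : seq T) :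
  exists s', forall x, In x s' <-> In x s /\ Q x.
Proof.
elim: s => [|y s [s' IH]]; first by exists [::] => x; split=> // -[].
have [Qy|nQy] := pselect (Q y); [exists (y :: s')|exists s'] => x /=; rewrite IH.
  by split=> [[<-|[]]|[[|]]]; tauto.
by split=> [[]|[[<-|]]]; tauto.
Qed.

(** * Back and forth *)

Section partial_isomorphism.
Variables (B M : Type) (ltB : B -> B -> Prop) (ltM : M -> M -> Prop).

Definition partial_iso (s : seq (B * M)) := forall p q, In p s -> In q s ->
  (p.1 = q.1 <-> p.2 = q.2) /\ (ltB p.1 q.1 <-> ltM p.2 q.2).

Hypothesis ltB_irr : forall b, ~ ltB b b.
Hypothesis ltB_trans : forall b c d, ltB b c -> ltB c d -> ltB b d.
Hypothesis ltM_irr : forall b, ~ ltM b b.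
Hypothesis extM : extension_property ltM.
Hypothesis ltM_trans : forall b c d, ltM b c -> ltM c d -> ltM b d.

Lemma partial_iso_le s p q : partial_iso s -> In p s -> In q s ->
  le ltB p.1 q.1 <-> le ltM p.2 q.2.
Proof.
by move=> si sp sq; have [e l] := si p q sp sq; rewrite /le e l.
Qed.

(** The points already matched split into those below [b], above [b] and incomparable with [b]; the
    extension property on their partners yields a partner for [b]. *)
Lemma forth s b : partial_iso s -> exists2 s', partial_iso s' &
  (forall p, In p s -> In p s') /\ exists m, In (b, m) s'.
Proof.
move=> si; have [[m bm]|nb] := pselect (exists m, In (b, m) s).
  by exists s => //; split=> //; exists m.
have bne p : In p s -> p.1 <> b.
  by case: p => c m sp /= e; apply: nb; exists m; rewrite -e.
have [SL SLP] := in_sub (fun p : B * M => ltB p.1 b) s.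
have [SU SUP] := in_sub (fun p : B * M => ltB b p.1) s.
have [SY SYP] := in_sub (fun p : B * M => ~ ltB p.1 b /\ ~ ltB b p.1) s.
have [|||m [Lm mU Ym]] := @extM (map snd SL) (map snd SU) (map snd SY).
- move=> _ _ /in_map [p /SLP [sp pb] ->] /in_map [q /SUP [sq bq] ->].
  by have [_ <-] := si _ _ sp sq; apply: ltB_trans bq.
- move=> _ _ /in_map [p /SYP [sp [npb nbp]] ->] /in_map [q /SLP [sq qb] ->].
  move=> /(partial_iso_le si sp sq) pq; apply: npb.
  exact: le_lt_trans ltB_trans _ _ _ pq qb.
- move=> _ _ /in_map [p /SYP [sp [npb nbp]] ->] /in_map [q /SUP [sq qb] ->].
  move=> /(partial_iso_le si sq sp) pq; apply: nbp.
  exact: lt_le_trans ltB_trans _ _ _ qb pq.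
have bmP p : In p s -> [/\ p.2 <> m, ltB p.1 b <-> ltM p.2 m & ltB b p.1 <-> ltM m p.2].
  move=> sp.
  have [pb|npb] := pselect (ltB p.1 b).
    have pm : ltM p.2 m by apply: Lm; apply/in_map; exists p => //; apply/SLP.
    split=> //; first by move=> e; rewrite e in pm; apply: ltM_irr pm.
    by split=> [bp|mp]; [case: (@ltB_irr b)|case: (@ltM_irr m)];
      [apply: ltB_trans pb|apply: ltM_trans pm].
  have [bp|nbp] := pselect (ltB b p.1).
    have mp : ltM m p.2 by apply: mU; apply/in_map; exists p => //; apply/SUP.
    split=> //; first by move=> e; rewrite e in mp; apply: ltM_irr mp.
    by split=> // pm; case: (@ltM_irr m); apply: ltM_trans pm.
  have [npm nmp] : ~ le ltM p.2 m /\ ~ le ltM m p.2.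
    by apply: Ym; apply/in_map; exists p => //; apply/SYP.
  split; first by move=> e; apply: npm; left.
    by split=> // pm; case: npm; right.
  by split=> // mp; case: nmp; right.
exists ((b, m) :: s); last by split; [move=> p; right|exists m; left].
move=> p q [<-|sp] [<-|sq] /=; last exact: si.
- by split=> //; split=> [/ltB_irr|/ltM_irr].
- have [qm qb bq] := bmP _ sq; split=> //.
  by split=> e; [case: (bne _ sq)|case: qm].
- have [pm pb bp] := bmP _ sp; split=> //.
  by split=> e; [case: (bne _ sp)|case: pm].
Qed.

End partial_isomorphism.

Lemma injects_nat_enum (T : Type) : injects_nat T ->
  exists e : nat -> option T, forall x, exists n, e n = Some x.
Proof.
move=> [f fI]; have /choice [e eE] : forall n, exists o : option T,
    forall x, f x = n -> o = Some x.
  move=> n; have [[x fx]|nx] := pselect (exists x, f x = n).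
    by exists (Some x) => y; rewrite -fx => /fI ->.
  by exists None => x fx; case: nx; exists x.
by exists e => x; exists (f x); apply: eE.
Qed.

Section back_and_forth.
Variables (B M : Type) (ltB : B -> B -> Prop) (ltM : M -> M -> Prop).
Hypothesis ltB_irr : forall b, ~ ltB b b.
Hypothesis ltB_trans : forall b c d, ltB b c -> ltB c d -> ltB b d.
Hypothesis ltM_irr : forall b, ~ ltM b b.
Hypothesis ltM_trans : forall b c d, ltM b c -> ltM c d -> ltM b d.
Hypothesis extB : extension_property ltB.
Hypothesis extM : extension_property ltM.

Definition swap (S T : Type) (p : S * T) := (p.2, p.1).

Lemma in_swap (S T : Type) (s : seq (S * T)) p : In p [seq swap x | x <- s] <-> In (swap p) s.
Proof.
rewrite in_map; split=> [[q sq ->]|sp]; first by case: q sq.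
by exists (swap p) => //; case: p {sp}.
Qed.

Lemma partial_iso_swap s :
  partial_iso ltB ltM s <-> partial_iso ltM ltB [seq swap x | x <- s].
Proof.
split=> si p q.
  by move=> /in_swap sp /in_swap sq; have [e l] := si _ _ sp sq; split; symmetry.
move=> sp sq; have [||e l] := si (swap p) (swap q); last by split; symmetry.
  by apply/in_swap; case: p sp.
by apply/in_swap; case: q sq.
Qed.

Lemma back s m : partial_iso ltB ltM s -> exists2 s', partial_iso ltB ltM s' &
  (forall p, In p s -> In p s') /\ exists b, In (b, m) s'.
Proof.
move=> /partial_iso_swap si.
have [s' si' [ss' [b bm]]] := forth ltM_irr ltM_trans ltB_irr extB ltB_trans m si.
have s'E : s' = [seq swap x | x <- [seq swap x | x <- s']].
  by rewrite mapK // => -[].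
exists [seq swap x | x <- s'].
  by apply/partial_iso_swap; rewrite -s'E.
split; last by exists b; apply/in_swap.
by move=> p sp; apply/in_swap/ss'/in_swap; case: p sp.
Qed.

Hypothesis countB : injects_nat B.
Hypothesis countM : injects_nat M.

Lemma back_and_forth : exists (f : B -> M) (f' : M -> B),
  [/\ cancel f f', cancel f' f & forall b c, ltM (f b) (f c) <-> ltB b c].
Proof.
have [eB eBP] := injects_nat_enum countB; have [eM eMP] := injects_nat_enum countM.
pose X := {s | partial_iso ltB ltM s}.
(* Step [n] puts the [n]-th entry of each enumeration, if any, into the partial isomorphism. *)
have /choice [next nextP] : forall c : nat * X, exists s' : X,
    [/\ forall p, In p (sval c.2) -> In p (sval s'),
        forall b, eB c.1 = Some b -> exists m, In (b, m) (sval s') &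
        forall m, eM c.1 = Some m -> exists b, In (b, m) (sval s')].
  move=> [n [s si]] /=.
  have [s1 s1i [ss1 s1b]] : exists2 s', partial_iso ltB ltM s' &
      (forall p, In p s -> In p s') /\
      forall b, eB n = Some b -> exists m, In (b, m) s'.
    case: (eB n) => [b|]; last by exists s.
    have [s1 s1i [ss1 s1b]] := forth ltB_irr ltB_trans ltM_irr extM ltM_trans b si.
    by exists s1 => //; split=> // _ [<-].
  have [s2 s2i [s12 s2m]] : exists2 s', partial_iso ltB ltM s' &
      (forall p, In p s1 -> In p s') /\
      forall m, eM n = Some m -> exists b, In (b, m) s'.
    case: (eM n) => [m|]; last by exists s1.
    have [s2 s2i [s12 s2m]] := back m s1i.
    by exists s2 => //; split=> // _ [<-].
  exists (exist _ s2 s2i); split=> //= [p /ss1 /s12 //|b /s1b [m]].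
  by exists m; apply: s12.
have nil_iso : partial_iso ltB ltM [::] by [].
pose fix chain n : X :=
  if n is m.+1 then next (m, chain m) else exist _ [::] nil_iso.
pose R b m := exists n, In (b, m) (sval (chain n)).
have chain_le n k p : In p (sval (chain n)) -> In p (sval (chain (k + n))).
  by elim: k => // k IH /IH; have [+ _ _] := nextP (k + n, chain (k + n)); apply.
have RP b m c k : R b m -> R c k -> (b = c <-> m = k) /\ (ltB b c <-> ltM m k).
  move=> [n1 bm] [n2 ck].
  apply: (svalP (chain (n1 + n2)) (b, m) (c, k)); last exact: chain_le.
  by rewrite addnC; apply: chain_le.
have /choice [f fR] : forall b, exists m, R b m.
  move=> b; have [n en] := eBP b.
  have [_ /(_ _ en) [m bm] _] := nextP (n, chain n).
  by exists m, n.+1.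
have /choice [f' f'R] : forall m, exists b, R b m.
  move=> m; have [n en] := eMP m.
  have [_ _ /(_ _ en) [b bm]] := nextP (n, chain n).
  by exists b, n.+1.
exists f, f'; split.
- by move=> b; have [[_ e] _] := RP _ _ _ _ (f'R (f b)) (fR b); apply: e.
- by move=> m; have [[e _] _] := RP _ _ _ _ (fR (f' m)) (f'R m); apply: e.
- by move=> b c; have [_ ->] := RP _ _ _ _ (fR b) (fR c).
Qed.

End back_and_forth.

(** * The extension property of the generic poset *)

Section generic_extension.
Local Open Scope order_scope.
Import Order.TTheory.
Variables (d : Order.disp_t) (M : porderType d).

Lemma inP (s : seq M) x : reflect (In x s) (x \in s).
Proof.
apply: (iffP idP); elim: s => //= y s IH; rewrite inE.
  by case/orP=> [/eqP ->|/IH]; [left|right].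
by case=> [->|/IH ->]; rewrite ?eqxx ?orbT.
Qed.

Lemma embed_rel (T : finType) (r : rel T) : embeds_finite_posets M ->
  irreflexive r -> transitive r ->
  exists2 f : T -> M, injective f & forall x y, (f x < f y) = r x y.
Proof.
move=> emb rirr rtr.
pose mix := Order.Lt_isPOrder.Build Order.default_display T rirr rtr.
pose F : finPOrderType Order.default_display := HB.pack T mix.
by have [f [fI fE]] := emb _ F; exists f.
Qed.

(** Adjoin to the finite set [s] one point [None] of the required type and embed the result in [M].
    Ultrahomogeneity moves the copy of [s] back onto [s], and the image of [None] is the desired
    element. *)
Lemma generic_extension : generic_poset M ->
  extension_property (fun x y : M => x < y).
Proof.
move=> [_ hom emb] L U Y LU YL YU.
pose s : seq M := L ++ U ++ Y.
pose T := option (seq_sub s).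
pose r (x y : T) : bool :=
  match x, y with
  | Some a, Some b => val a < val b
  | Some a, None => has (fun l => val a <= l) L
  | None, Some b => has (fun u => u <= val b) U
  | None, None => false
  end.
have LU' l u : l \in L -> u \in U -> l < u.
  by move=> /inP Ll /inP Uu; apply: LU.
have rirr : irreflexive r by case=> [a|] //=; rewrite ltxx.
have rtr : transitive r.
  move=> [b|] [a|] [c|] //=.
  - exact: lt_trans.
  - by move=> ab /hasP [l Ll bl]; apply/hasP; exists l => //; apply: le_trans (ltW ab) bl.
  - by move=> /hasP [u Uu ub] bc; apply/hasP; exists u => //; apply: le_trans ub (ltW bc).
  - move=> /hasP [u Uu ub] /hasP [l Ll bl].
    by have := lt_le_trans (LU' _ _ Ll Uu) (le_trans ub bl); rewrite ltxx.
  - move=> /hasP [l Ll al] /hasP [u Uu uc].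
    exact: le_lt_trans al (lt_le_trans (LU' _ _ Ll Uu) uc).
have [f fI fE] := embed_rel emb rirr rtr.
(* [h] inverts the embedding on the copy of [s] and is the identity elsewhere. *)
have /choice [h hE] : forall x, exists y, forall a : seq_sub s,
    x = f (Some a) -> y = val a.
  move=> x; have [[a ->]|na] := pselect (exists a : seq_sub s, x = f (Some a)).
    by exists (val a) => b /fI [->].
  by exists x => a xa; case: na; exists a.
have {}hE a : h (f (Some a)) = val a by apply: hE.
have [|||g [[gbij gE] gh]] := hom (range (fun a : seq_sub s => f (Some a))) [set` s] h.
- by apply: finite_image; apply: finite_finset.
- exact: finite_seq.
- split; [split|].
  + by move=> _ [a _ <-] /=; rewrite hE; apply: valP.
  + move=> x y /set_mem [a _ <-] /set_mem [b _ <-].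
    by rewrite !hE => /val_inj ->.
  + by move=> x sx; exists (f (Some (SeqSub sx))); [exists (SeqSub sx)|rewrite hE].
  + move=> x y /set_mem [a _ <-] /set_mem [b _ <-].
    by rewrite !hE fE.
have gI : injective g by apply: bij_inj.
have {}gh (x : M) (sx : x \in s) : g (f (Some (SeqSub sx))) = x.
  by rewrite gh ?hE //; apply/mem_set; exists (SeqSub sx).
have Ls x : In x L -> x \in s by move=> /inP; rewrite !mem_cat => ->.
have Us x : In x U -> x \in s by move=> /inP; rewrite !mem_cat => ->; rewrite orbT.
have Ys x : In x Y -> x \in s by move=> /inP; rewrite !mem_cat => ->; rewrite !orbT.
exists (g (f None)); split.
- move=> l Ll; rewrite -(gh l (Ls l Ll)) gE fE /=.
  by apply/hasP; exists l => //; apply/inP.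
- move=> u Uu; rewrite -(gh u (Us u Uu)) gE fE /=.
  by apply/hasP; exists u => //; apply/inP.
- move=> y Yy; rewrite -(gh y (Ys y Yy)); split=> -[/gI /fI //|]; rewrite gE fE /=.
    move=> /hasP [l /inP Ll]; rewrite le_eqVlt => yl; apply: (YL y l Yy Ll).
    by case/orP: yl => [/eqP|]; [left|right].
  move=> /hasP [u /inP Uu]; rewrite le_eqVlt => uy; apply: (YU y u Yy Uu).
  by case/orP: uy => [/eqP|]; [left|right].
Qed.

End generic_extension.

(** * Transport from the limit to the generic poset *)

Theorem rigid_embedding (A : zposet) (M : Type) (ltM : M -> M -> Prop) :
  injects_nat A -> injects_nat M ->
  (forall x, ~ ltM x x) -> (forall x y z, ltM x y -> ltM y z -> ltM x z) ->
  extension_property ltM ->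
  exists f : A -> M,
    [/\ injective f, forall a b, ltM (f a) (f b) <-> lt a b,
        exists2 j : nat -> M, injective j & forall i a, f a <> j i,
        forall a : zaut A, exists g g', order_aut ltM g g' /\
          forall x, g (f x) = f (fwd a x) &
        forall g g', order_aut ltM g g' -> (forall x, g (f x) = f x) ->
          forall y, g y = y].
Proof.
move=> cA cM Mirr Mtr Mext.
have [phi [psi [phiK psiK phiE]]] :=
  back_and_forth (@lim_lt_irr A) (@lim_lt_trans A) Mirr Mtr
    (@limit_extension A) Mext (injects_nat_limit cA) cM.
have psiE x y : lim_lt (psi x) (psi y) <-> ltM x y by rewrite -phiE !psiK.
have phiI := can_inj phiK.
exists (fun a => phi (inl a)); split.
- by move=> a b /phiI [].
- by move=> a b; rewrite phiE; apply: (@lim_ltE A 0).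
(* The cuts with empty sides added at the first step give infinitely many points outside the
   image. *)
- exists (fun j => phi (nu (Cut j (valid_cut0 (stage A 0))))) => [i j|i a].
    by move=> /phiI /nu_inj [].
  by move/phiI.
- move=> a; have [gK g'K gE] := limit_map_aut a.
  exists (phi \o limit_map a \o psi), (phi \o limit_map_inv a \o psi).
  split=> [|x /=]; last by rewrite phiK.
  split=> [x|x|x y] /=; [by rewrite phiK gK psiK|by rewrite phiK g'K psiK|].
  by rewrite phiE gE psiE.
- move=> g g' [gK g'K gE] gf y.
  rewrite -{2}[y]psiK -[g y]psiK; congr phi; rewrite -{1}[y]psiK.
  apply: (@limit_rigid A (psi \o g \o phi) (psi \o g' \o phi)).
    split=> [b|b|b c] /=; [by rewrite psiK gK phiK|by rewrite psiK g'K phiK|].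
    by rewrite psiE gE phiE.
  by move=> a /=; rewrite gf phiK.
Qed.

(** * Invariant sets that are not finitely generated *)

Section infinite_poset.
Variables (T : Type) (lt : T -> T -> Prop).
Hypothesis lt_irr : forall x, ~ lt x x.
Hypothesis lt_trans : forall x y z, lt x y -> lt y z -> lt x z.

Definition no_maximal (X : set T) := forall x, X x -> exists2 y, X y & lt x y.

(* If [ascending] is nonempty it is a down-set that is not finitely generated;
   if it is empty then every nonempty set has a maximal element, and
   [finitely_exceeded] is an up-set that is not finitely generated. *)
Definition ascending : set T := [set x | exists2 X, no_maximal X & X x].

Definition finitely_exceeded : set T := [set x | finite_set [set y | le lt x y]].

Lemma ascending_no_maximal : no_maximal ascending.
Proof.
by move=> x [X Xn /Xn [y Xy xy]]; exists y => //; exists X.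
Qed.

Lemma ascending_down x y : lt x y -> ascending y -> ascending x.
Proof.
move=> xy [X Xn Xy]; exists (x |` X); last by left.
move=> z [->|/Xn [w Xw zw]]; first by exists y => //; right.
by exists w => //; right.
Qed.

Lemma maximal_in_seq (F : seq T) x : In x F ->
  exists2 f, In f F & forall f', In f' F -> ~ lt f f'.
Proof.
elim: F x => // y F IH x _; have [[z Fz]|F0] := pselect (exists z, In z F); last first.
  exists y; first by left.
  by move=> f' [<-|Ff']; [apply: lt_irr|case: F0; exists f'].
have [f Ff fmax] := IH z Fz; have [fy|nfy] := pselect (lt f y).
  exists y; first by left.
  move=> f' [<-|Ff']; [exact: lt_irr|move=> yf'].
  by apply: (fmax f') => //; apply: lt_trans yf'.
by exists f; [right|move=> f' [<-//|/fmax]].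
Qed.

(** A maximal element of a finite generating sequence would itself be exceeded within the set, hence
    by another generator. *)
Lemma ascending_not_fin_gen : ascending !=set0 -> ~ fin_gen lt ascending.
Proof.
move=> [x Ax] [F AF]; have : down lt F x by rewrite -AF.
case=> f Ff _; have [m Fm mmax] := maximal_in_seq Ff.
have : ascending m by rewrite AF; apply: in_down.
move=> /ascending_no_maximal [y + my]; rewrite AF => -[f' Ff' yf'].
by apply: (mmax f') => //; apply: lt_le_trans yf'.
Qed.

Lemma finitely_exceeded_up x y : lt x y -> finitely_exceeded x -> finitely_exceeded y.
Proof.
move=> xy; apply: sub_finite_set => z yz; apply: le_trans yz => //.
by right.
Qed.

Lemma finite_up (F : seq T) : (forall f, In f F -> finitely_exceeded f) ->
  finite_set (up lt F).
Proof.
elim: F => [|f F IH] Ff; first by rewrite up_nil; apply: finite_set0.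
apply: (@sub_finite_set _ _ ([set y | le lt f y] `|` up lt F)).
  by move=> y [g [<-|Fg] gy]; [left|right; exists g].
rewrite finite_setU; split; first by apply: Ff; left.
by apply: IH => g Fg; apply: Ff; right.
Qed.

(** If finitely generated, the set would be finite, so its complement would be nonempty and, with
    [ascending] empty, have a maximal element [m]. All elements above [m] would then lie in a finite
    set, putting [m] in [finitely_exceeded]. *)
Lemma finitely_exceeded_not_fin_gen : infinite_set [set: T] ->
  ascending = set0 -> ~ exists F, finitely_exceeded = up lt F.
Proof.
move=> Tinf A0 [F FE].
have Ffin : finite_set finitely_exceeded.
  by rewrite FE; apply: finite_up => f Ff; rewrite FE; apply: in_up.
have [x nFx] : exists x, ~ finitely_exceeded x.
  apply: contrapT => nx; apply: Tinf; apply: sub_finite_set Ffin => x _.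
  by apply: contrapT => nFx; apply: nx; exists x.
have [m nFm mmax] : exists2 m, ~ finitely_exceeded m &
    forall y, lt m y -> finitely_exceeded y.
  apply: contrapT => nm; suff : ascending x by rewrite A0.
  exists (~` finitely_exceeded) => // y nFy; apply: contrapT => ny; apply: nm.
  by exists y => // z yz; apply: contrapT => nFz; apply: ny; exists z.
apply: nFm; apply: (@sub_finite_set _ _ (m |` finitely_exceeded)).
  by move=> y [->|/mmax]; [left|right].
by rewrite finite_setU; split=> //; apply: finite_set1.
Qed.

Lemma ascending_aut g g' x : order_aut lt g g' -> ascending x -> ascending (g x).
Proof.
move=> [gK g'K gE] [X Xn Xx]; exists (g @` X); last by exists x.
by move=> _ [y /Xn [z Xz yz] <-]; exists (g z); [exists z|apply/gE].
Qed.

Lemma finitely_exceeded_aut g g' x :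
  order_aut lt g g' -> finitely_exceeded x -> finitely_exceeded (g x).
Proof.
move=> [gK g'K gE] /(finite_image g); apply: sub_finite_set => y gy.
exists (g' y) => //; case: gy => [<-|gy]; first by left; rewrite gK.
by right; rewrite -gE g'K.
Qed.

Lemma order_aut_flip g g' : order_aut lt g g' <-> order_aut (fun x y => lt y x) g g'.
Proof. by split; case=> ? ? gE; split. Qed.

End infinite_poset.

(** * Orientation of the order and the invariant down-set *)

Section directed.
Local Open Scope order_scope.
Import Order.TTheory.

Definition dir_lt (dir : bool) (d : Order.disp_t) (T : porderType d) (x y : T) : Prop :=
  if dir then x < y else y < x.

Lemma dir_lt_irr dir d (T : porderType d) (x : T) : ~ dir_lt dir x x.
Proof. by case: dir; rewrite /dir_lt ltxx. Qed.

Lemma dir_lt_trans dir d (T : porderType d) (x y z : T) :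
  dir_lt dir x y -> dir_lt dir y z -> dir_lt dir x z.
Proof.
by case: dir => [xy|xy yz]; [apply: lt_trans xy|apply: lt_trans xy].
Qed.

Lemma dir_lt_homo dir d d' (S : porderType d) (T : porderType d') (f : S -> T) (x y : S) :
  (f x < f y) = (x < y) -> (f y < f x) = (y < x) ->
  dir_lt dir (f x) (f y) <-> dir_lt dir x y.
Proof. by case: dir => xy yx; rewrite /dir_lt ?xy ?yx. Qed.

Lemma dir_lt_mono dir d d' (S : porderType d) (T : porderType d') (f : S -> T) :
  (forall x y, dir_lt dir (f x) (f y) <-> dir_lt dir x y) <->
  {mono f : x y / x < y}.
Proof.
split=> fE x y; last exact: dir_lt_homo.
case: dir fE => fE; have := fE x y; have := fE y x; rewrite /dir_lt;
  by move=> [? ?] [? ?]; apply/idP/idP.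
Qed.

Lemma dir_extension dir d (M : porderType d) :
  generic_poset M -> extension_property (@dir_lt dir d M).
Proof.
move=> /generic_extension ext; case: dir => // L U Y LU YL YU.
have [|||m [Um mL Ym]] := ext U L Y.
- by move=> l u Ul Lu; apply: LU.
- by move=> y l Yy Ul [e|yl]; apply: (YU y l) => //; [left|right].
- by move=> y u Yy Lu [e|yu]; apply: (YL y u) => //; [left|right].
exists m; split=> // y /Ym [ym my]; split=> -[e|].
- by apply: ym; left.
- by move=> ?; apply: my; right.
- by apply: my; left.
- by move=> ?; apply: ym; right.
Qed.

Lemma exists_invariant_down d (A : porderType d) : infinite_set [set: A] ->
  exists dir (Z : set A),
    [/\ forall p q, dir_lt dir p q -> Z q -> Z p,
        ~ fin_gen (@dir_lt dir d A) Z &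
        forall g g', order_aut (@dir_lt dir d A) g g' -> forall x, Z (g x) <-> Z x].
Proof.
move=> Ainf; have ltr := @dir_lt_trans true d A; have lti := @dir_lt_irr true d A.
have [A0|/set0P A0] := eqVneq (ascending (@dir_lt true d A)) set0; last first.
  exists true, (ascending (@dir_lt true d A)); split.
  - exact: ascending_down.
  - exact: ascending_not_fin_gen.
  - move=> g g' ga x; split; last exact: ascending_aut ga.
    move=> /(ascending_aut (order_aut_sym ga)).
    by case: ga => gK _ _; rewrite gK.
exists false, (finitely_exceeded (@dir_lt true d A)); split.
- by move=> p q pq; apply: (finitely_exceeded_up ltr (pq : dir_lt true q p)).
- move=> [F FE]; apply: (finitely_exceeded_not_fin_gen Ainf A0).
  exists F; rewrite FE; apply/predeqP => p.
  by split=> -[f Ff fp]; exists f => //; case: fp => [->|fp]; by [left|right].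
- move=> g g' /order_aut_flip ga x; split; last exact: finitely_exceeded_aut ga.
  move=> /(finitely_exceeded_aut (order_aut_sym ga)).
  by case: ga => gK _ _; rewrite gK.
Qed.

End directed.

Lemma countable_injects_nat (T : Type) : countable [set: T] -> injects_nat T.
Proof.
by move=> /countable_injP [f fI]; exists f => x y; apply: fI; rewrite inE.
Qed.

Theorem theorem5p1 (dM dA : Order.disp_t) (M : porderType dM)
    (A : porderType dA) (genM : generic_poset M)
    (countA : countable [set: A]) (infA : infinite_set [set: A]) :
  exists f : A -> M,
    [/\ poset_embedding f,
        infinite_set (~` range f) &
        forall h : M -> M, subposet_isomorphism (range f) (range f) h ->
          exists! g : M -> M, extends_to_automorphism (range f) h g].
Proof.
have [dir [Z [Zdown Znfg Zinv]]] := exists_invariant_down infA.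
pose ZA := ZPoset (@dir_lt_irr dir _ A) (@dir_lt_trans dir _ A) Zdown Znfg.
have [cM _ _] := genM.
have [f [fI fE [j jI jf] fext frigid]] :=
  @rigid_embedding ZA M (@dir_lt dir _ M) (countable_injects_nat countA)
    (countable_injects_nat cM) (@dir_lt_irr dir _ M) (@dir_lt_trans dir _ M)
    (dir_extension genM).
have {}fE a b : dir_lt dir (f a) (f b) <-> dir_lt dir a b by exact: fE.
exists f; split.
- by split=> //; apply/(@dir_lt_mono dir).
- move=> fin; apply: infinite_nat.
  have -> : [set: nat] = j @^-1` (~` range f).
    by apply/predeqP => i; split=> // _ [a _ /jf].
  by apply: finite_preimage fin => ? ? _ _; apply: jI.
move=> h [[hfun hinj hsurj] hE].
have rf a : f a \in range f by apply/mem_set; exists a.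
(* Conjugating [h] by [f] gives the automorphism [al] of [A], with inverse [al']; it preserves [Z]
   by invariance. *)
have /choice [al alE] : forall a, exists b, f b = h (f a).
  by move=> a; have [|b _ <-] := hfun (f a); [exists a|exists b].
have /choice [al' al'E] : forall b, exists a, h (f a) = f b.
  by move=> b; have [|_ [a _ <-] <-] := hsurj (f b); [exists b|exists a].
have alK : cancel al al'.
  by move=> a; apply: fI; apply: hinj => //; rewrite al'E alE.
have al'K : cancel al' al by move=> a; apply: fI; rewrite alE al'E.
have al_lt p q : dir_lt dir (al p) (al q) <-> dir_lt dir p q.
  by rewrite -(fE (al p)) !alE -fE; apply: dir_lt_homo; apply: hE.
pose alaut : zaut ZA := @ZAut ZA al al' alK al'K al_lt
  (Zinv al al' (And3 alK al'K al_lt)).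
have [g [g' [[gK g'K gE] gf]]] := fext alaut.
exists g; split.
  split; first by split; [exists g'|apply/(@dir_lt_mono dir)].
  by move=> x /set_mem [a _ <-]; rewrite gf /= alE.
move=> g2 [[[g2' g2K g2'K] g2E] g2h]; apply/funext => y.
have g2E' := (@dir_lt_mono dir _ _ _ _ g2).2 g2E.
(* Uniqueness: [g] followed by the inverse of another extension fixes the image of [f] pointwise, so
   rigidity applies. *)
suff e : g2' (g y) = y by rewrite -{2}e g2'K.
apply: (frigid (g2' \o g) (g' \o g2)) => [|a /=].
  split=> [x|x|x z] /=; [by rewrite g2'K gK|by rewrite g'K g2K|].
  by rewrite -(g2E' (g2' _)) !g2'K gE.
by rewrite gf /= alE -g2h ?g2K.
Qed.
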